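(* Let $G$ be a finitely generated LERF group with $\nabla G>0$. Then there exists a transitive right action of $G$ on a set $X$ such that: (1) only finitely many elements $g\in G$ act trivially on $X$; and (2) for every finitely generated subgroup $L$ of infinite index in $G$ and every $x\in X$, the orbit $xL$ is finite.
   Context: For a group $U$, $d(U)$ denotes the minimal cardinality of a generating set of $U$. The rank gradient of a finitely generated group $G$ is $\nabla G=\inf_U \frac{d(U)-1}{[G:U]}$, where $U$ ranges over all finite index subgroups of $G$. A group $G$ is LERF (subgroup separable) if every finitely generated subgroup of $G$ is the intersection of some collection of finite index subgroups of $G$. *)

(* Defs.v *)
From Stdlib Require Import Reals List.
Open Scope R_scope.

Record IsGroup (G : Type) (mul : G -> G -> G) (e : G) (inv : G -> G) : Prop := {
  grp_assoc : forall x y z, mul x (mul y z) = mul (mul x y) z;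
  grp_idl : forall x, mul e x = x;
  grp_idr : forall x, mul x e = x;
  grp_invl : forall x, mul (inv x) x = e;
  grp_invr : forall x, mul x (inv x) = e }.

Section GroupDefs.
Variables (G : Type) (mul : G -> G -> G) (e : G) (inv : G -> G).

Definition is_subgroup (H : G -> Prop) : Prop :=
  H e /\ (forall x y, H x -> H y -> H (mul x y)) /\ (forall x, H x -> H (inv x)).

Definition gen (S : G -> Prop) (x : G) : Prop :=
  forall H, is_subgroup H -> (forall y, S y -> H y) -> H x.

Definition generated_by_list (U : G -> Prop) (l : list G) : Prop :=
  NoDup l /\ (forall y, In y l -> U y) /\
  (forall x, U x <-> gen (fun y => In y l) x).

Definition fin_gen_subgroup (U : G -> Prop) : Prop :=
  is_subgroup U /\ exists l, generated_by_list U l.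

Definition fin_gen_group : Prop := exists l, generated_by_list (fun _ => True) l.

Definition min_gen_card (U : G -> Prop) (n : nat) : Prop :=
  (exists l, generated_by_list U l /\ length l = n) /\
  (forall l, generated_by_list U l -> (n <= length l)%nat).

(* [G : U] = n : the right cosets U g are represented by exactly n distinct
   representatives (U g = U t  iff  g t^-1 \in U). *)
Definition index_eq (U : G -> Prop) (n : nat) : Prop :=
  exists l : list G, length l = n /\
    (forall g, exists t, In t l /\ U (mul g (inv t))) /\
    (forall i j, (i < n)%nat -> (j < n)%nat ->
       U (mul (nth i l e) (inv (nth j l e))) -> i = j).

Definition finite_index_subgroup (U : G -> Prop) : Prop :=
  is_subgroup U /\ exists n, index_eq U n.

Definition LERF : Prop :=
  forall H, fin_gen_subgroup H ->
    forall x, H x <-> (forall K, finite_index_subgroup K ->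
                          (forall y, H y -> K y) -> K x).

Definition rank_gradient_values (r : R) : Prop :=
  exists U d n, finite_index_subgroup U /\ min_gen_card U d /\ index_eq U n /\
    r = (INR d - 1) / INR n.

Definition is_inf (P : R -> Prop) (r : R) : Prop :=
  (forall s, P s -> r <= s) /\ (forall r', (forall s, P s -> r' <= s) -> r' <= r).

Definition rank_gradient_is (r : R) : Prop := is_inf rank_gradient_values r.

Definition is_right_action (X : Type) (act : X -> G -> X) : Prop :=
  (forall x, act x e = x) /\ (forall x g h, act x (mul g h) = act (act x g) h).

Definition transitive_action (X : Type) (act : X -> G -> X) : Prop :=
  forall x y, exists g, act x g = y.

Definition finite_set {T : Type} (P : T -> Prop) : Prop :=
  exists l : list T, forall t, P t -> In t l.

End GroupDefs.

(* Main.v *)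
Require Import Defs.
From Stdlib Require Import Reals List Lia Lra Arith Cantor.
From Stdlib Require Import Classical ClassicalEpsilon FunctionalExtensionality
  PropExtensionality ProofIrrelevance.
Open Scope R_scope.

(** A subgroup of finite index [n] generated by [s] elements has [c n <= s] for some
    [c > 0]. Let [A], [B] be finitely generated of infinite index. By separability [B]
    lies in some [V] of finite index with [c [G:V] > d(B)]; in the normal core [K] of
    [V], all conjugates of [B /\ K] need fewer than [c [G:K]] generators. If [C <= K] is
    finitely generated of infinite index and [C <= U <= K] with [[K:U]] large, then by
    Schreier [<C, B /\ U>] is generated by too few elements to have finite index.
    Starting from [A /\ K] and adjoining in turn the conjugates of [B /\ K] by a
    transversal of [A] modulo [K], one obtains [U] of finite index such that
    [<A, B /\ U>] has infinite index.

    If [A] contains a normal subgroup [M] of [G] with at least [m] elements, take [W] of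
    finite index in some [U >= A] of large index, with [W] separating [m] elements of
    [M]. Then [W] is generated by [W /\ A] and by lifts of generators of [M W],
    hence by about [d(G) [G:W] / m] elements, so [c m <= d(G)].

    Enumerating the pairs of a finitely generated subgroup and a conjugator, one builds
    an increasing chain of finitely generated subgroups of infinite index that absorbs
    a finite index part of every conjugate of every finitely generated subgroup of
    infinite index. By separability each step can avoid finitely many prescribed
    elements, which keeps every set of more than [d(G) / c] elements out of the core
    of the union [H]. The action is that of [G] on the right cosets of [H]. *)

(** * Lists *)

(** Delete from [l] the element [t] matched with the head of [s]: by hypothesis no later element of
    [s] is related to [t], so induction applies to what is left. *)
Lemma pigeonhole_rel (T : Type) (R : T -> T -> Prop) (s l : list T) :
  ForallOrdPairs (fun x y => forall z, R x z -> R y z -> False) s ->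
  (forall x, In x s -> exists t, In t l /\ R x t) ->
  (length s <= length l)%nat.
Proof.
  intros Hs; revert l; induction Hs as [|x s Hx Hs IH]; intros l Hl; simpl; [lia|].
  destruct (Hl x (or_introl eq_refl)) as [t [Ht Rt]].
  apply in_split in Ht as [l1 [l2 ->]].
  rewrite Forall_forall in Hx.
  assert (H : (length s <= length (l1 ++ l2))%nat).
  { apply IH; intros y Hy.
    destruct (Hl y (or_intror Hy)) as [u [Hu Ru]].
    exists u; split; auto.
    apply in_app_iff in Hu; apply in_app_iff; simpl in Hu.
    destruct Hu as [Hu|[<-|Hu]]; auto.
    destruct (Hx y Hy t Rt Ru). }
  rewrite !length_app in *; simpl; lia.
Qed.

(** Greedy choice: while a scattered list fails to cover, a point related to none of its entries can
    be put in front. Applied to coset relations it separates small from large index, applied to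
    equality small from large sets. *)
Lemma cover_or_scattered (T : Type) (P : T -> Prop) (R : T -> T -> Prop) (n : nat) :
  (exists l, (length l < n)%nat /\ (forall t, In t l -> P t) /\
     ForallOrdPairs (fun x y => ~ R x y) l /\
     (forall x, P x -> exists t, In t l /\ R x t)) \/
  (exists l, length l = n /\ (forall t, In t l -> P t) /\
     ForallOrdPairs (fun x y => ~ R x y) l).
Proof.
  induction n as [|n [[l Hl]|[l [Hn [HP HR]]]]].
  - right; exists nil; repeat split; [intros t []|constructor].
  - left; exists l; intuition lia.
  - destruct (classic (forall x, P x -> exists t, In t l /\ R x t)) as [H|H].
    + left; exists l; intuition lia.
    + apply not_all_ex_not in H as [x H].
      apply imply_to_and in H as [Px H].
      right; exists (x :: l); simpl; repeat split.
      * lia.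
      * intros t [<-|Ht]; auto.
      * constructor; auto. apply Forall_forall; intros y Hy Rxy; apply H; eauto.
Qed.

Lemma Forall2_exists (S T : Type) (R : S -> T -> Prop) (l : list S) :
  (forall x, In x l -> exists y, R x y) -> exists l', Forall2 R l l'.
Proof.
  induction l as [|x l IH]; intros H.
  - exists nil; constructor.
  - destruct (H x (or_introl eq_refl)) as [y Hy].
    destruct IH as [l' Hl']; [intros z Hz; apply H; now right|].
    exists (y :: l'); now constructor.
Qed.

Lemma Forall2_in_l (S T : Type) (R : S -> T -> Prop) (l : list S) (l' : list T) x :
  Forall2 R l l' -> In x l -> exists y, In y l' /\ R x y.
Proof.
  induction 1 as [|a b l l' Hab H IH]; intros Hx; [destruct Hx|].
  destruct Hx as [->|Hx]; [exists b; simpl; auto|].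
  destruct (IH Hx) as [y [Hy Ry]]; exists y; simpl; auto.
Qed.

Lemma Forall2_in_r (S T : Type) (R : S -> T -> Prop) (l : list S) (l' : list T) y :
  Forall2 R l l' -> In y l' -> exists x, In x l /\ R x y.
Proof.
  induction 1 as [|a b l l' Hab H IH]; intros Hy; [destruct Hy|].
  destruct Hy as [->|Hy]; [exists a; simpl; auto|].
  destruct (IH Hy) as [x [Hx Rx]]; exists x; simpl; auto.
Qed.

Lemma ForallOrdPairs_app (T : Type) (R : T -> T -> Prop) (l l' : list T) :
  ForallOrdPairs R l -> ForallOrdPairs R l' ->
  (forall x y, In x l -> In y l' -> R x y) -> ForallOrdPairs R (l ++ l').
Proof.
  intros H H' Hc; induction H as [|x l Hx H IH]; simpl; auto.
  constructor.
  - apply Forall_app; split; auto.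
    apply Forall_forall; intros y Hy; apply Hc; simpl; auto.
  - apply IH; intros; apply Hc; simpl; auto.
Qed.

Lemma ForallOrdPairs_imp (T : Type) (R R' : T -> T -> Prop) (l : list T) :
  (forall x y, R x y -> R' x y) -> ForallOrdPairs R l -> ForallOrdPairs R' l.
Proof.
  intros HR H; induction H as [|x l Hx H IH]; constructor; auto.
  eapply Forall_impl; [|exact Hx]; auto.
Qed.

Lemma ForallOrdPairs_map (S T : Type) (f : S -> T) (R : T -> T -> Prop) (l : list S) :
  ForallOrdPairs (fun x y => R (f x) (f y)) l -> ForallOrdPairs R (map f l).
Proof.
  intros H; induction H as [|x l Hx H IH]; simpl; constructor; auto.
  now apply Forall_map.
Qed.

Lemma ForallOrdPairs_nth (T : Type) (R : T -> T -> Prop) (l : list T) (d : T) i j :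
  ForallOrdPairs R l -> (i < j < length l)%nat -> R (nth i l d) (nth j l d).
Proof.
  intros H; revert i j; induction H as [|x l Hx H IH]; simpl; intros i j Hij; [lia|].
  destruct j as [|j]; [lia|]. destruct i as [|i].
  - rewrite Forall_forall in Hx; apply Hx, nth_In; lia.
  - apply IH; lia.
Qed.

Lemma NoDup_ForallOrdPairs (T : Type) (l : list T) :
  NoDup l <-> ForallOrdPairs (fun x y => ~ x = y) l.
Proof.
  split; induction 1 as [|x l Hx H IH]; constructor; auto.
  - apply Forall_forall; intros y Hy ->; auto.
  - rewrite Forall_forall in Hx; intros Hin; exact (Hx x Hin eq_refl).
Qed.

Lemma NoDup_refinement (T : Type) (l : list T) :
  exists l', NoDup l' /\ (forall x, In x l' <-> In x l) /\ (length l' <= length l)%nat.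
Proof.
  induction l as [|x l [l' [Hn [Hi Hl]]]].
  - exists nil; repeat split; auto; constructor.
  - destruct (classic (In x l')) as [Hx|Hx].
    + exists l'; split; [auto|split; [|simpl; lia]].
      intros y; simpl; rewrite <- Hi; split; [auto|now intros [<-|Hy]].
    + exists (x :: l'); split; [now constructor|split; [|simpl; lia]].
      intros y; simpl; now rewrite Hi.
Qed.

Fixpoint decode_list (k m : nat) : list nat :=
  match k with
  | O => nil
  | S k => let (a, b) := Cantor.of_nat m in a :: decode_list k b
  end.

Lemma decode_list_surj (l : list nat) : exists m, decode_list (length l) m = l.
Proof.
  induction l as [|a l [m IH]]; simpl; [now exists O|].
  exists (Cantor.to_nat (a, m)); rewrite Cantor.cancel_of_to; now rewrite IH.
Qed.

Lemma list_nat_enum : exists f : nat -> list nat, forall l, exists n, f n = l.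
Proof.
  exists (fun n => let (k, m) := Cantor.of_nat n in decode_list k m); intros l.
  destruct (decode_list_surj l) as [m Hm].
  exists (Cantor.to_nat (length l, m)); now rewrite Cantor.cancel_of_to.
Qed.

(** * Subgroups, cosets and generators *)

Section Groups.

Context (G : Type) (mul : G -> G -> G) (e : G) (inv : G -> G).
Context (HG : IsGroup G mul e inv).

Local Notation "x ** y" := (mul x y) (at level 40, left associativity).
Local Notation sub := (is_subgroup G mul e inv).
Local Notation gen := (gen G mul e inv).

Lemma mulA x y z : x ** (y ** z) = x ** y ** z. Proof. apply HG. Qed.
Lemma mul1l x : e ** x = x. Proof. apply HG. Qed.
Lemma mul1r x : x ** e = x. Proof. apply HG. Qed.
Lemma mulVl x : inv x ** x = e. Proof. apply HG. Qed.
Lemma mulVr x : x ** inv x = e. Proof. apply HG. Qed.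
Lemma mulKl x y : x ** inv y ** y = x.
Proof. now rewrite <- mulA, mulVl, mul1r. Qed.
Lemma mulKr x y : x ** y ** inv y = x.
Proof. now rewrite <- mulA, mulVr, mul1r. Qed.

Lemma inv_uniq x y : x ** y = e -> inv x = y.
Proof.
  intros H. rewrite <- (mul1r (inv x)), <- H, mulA, mulVl. apply mul1l.
Qed.

Lemma invM x y : inv (x ** y) = inv y ** inv x.
Proof. apply inv_uniq. now rewrite mulA, mulKr, mulVr. Qed.
Lemma invK x : inv (inv x) = x.
Proof. apply inv_uniq, mulVl. Qed.
Lemma inv1 : inv e = e.
Proof. apply inv_uniq, mul1l. Qed.

Ltac gsimp :=
  repeat (rewrite mulA || rewrite mul1l || rewrite mul1r || rewrite mulVl ||
          rewrite mulVr || rewrite mulKl || rewrite mulKr || rewrite invM ||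
          rewrite invK || rewrite inv1).

Lemma sub_e H : sub H -> H e. Proof. intros h; apply h. Qed.
Lemma sub_m H x y : sub H -> H x -> H y -> H (x ** y).
Proof. intros h; apply h. Qed.
Lemma sub_v H x : sub H -> H x -> H (inv x). Proof. intros h; apply h. Qed.

Lemma sub_full : sub (fun _ => True).
Proof. repeat split. Qed.

Lemma sub_inter H K : sub H -> sub K -> sub (fun x => H x /\ K x).
Proof. unfold is_subgroup; intuition auto. Qed.

(** * Conjugation and generated subgroups *)

Definition conjg (g x : G) : G := g ** x ** inv g.

Lemma conjM g x y : conjg g (x ** y) = conjg g x ** conjg g y.
Proof. unfold conjg; now gsimp. Qed.
Lemma conjV g x : conjg g (inv x) = inv (conjg g x).
Proof. unfold conjg; now gsimp. Qed.
Lemma conj1 g : conjg g e = e.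
Proof. unfold conjg; now gsimp. Qed.
Lemma conj_comp g h x : conjg g (conjg h x) = conjg (g ** h) x.
Proof. unfold conjg; now gsimp. Qed.
Lemma conjK g x : conjg g (conjg (inv g) x) = x.
Proof. unfold conjg; now gsimp. Qed.
Lemma conjKV g x : conjg (inv g) (conjg g x) = x.
Proof. unfold conjg; now gsimp. Qed.

Lemma sub_conj g H : sub H -> sub (fun x => H (conjg g x)).
Proof.
  intros h; repeat split; intros.
  - rewrite conj1; now apply sub_e.
  - rewrite conjM; now apply sub_m.
  - rewrite conjV; now apply sub_v.
Qed.

Lemma gen_sub S : sub (gen S).
Proof.
  repeat split.
  - intros H h _; apply h.
  - intros x y Hx Hy H h hS; apply h; [now apply Hx|now apply Hy].
  - intros x Hx H h hS; apply h; now apply Hx.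
Qed.

Lemma gen_in (S : G -> Prop) x : S x -> gen S x.
Proof. intros Hx H h hS; auto. Qed.

Lemma gen_min (S H : G -> Prop) x : sub H -> (forall y, S y -> H y) -> gen S x -> H x.
Proof. intros h hS Hx; now apply Hx. Qed.

(** The elements [x] such that right multiplication by [x] and by [inv x] preserves [Q] form a
    subgroup containing [S]. *)
Lemma gen_right_ind (S Q : G -> Prop) :
  Q e -> (forall x y, Q x -> S y -> Q (x ** y)) ->
  (forall x y, Q x -> S y -> Q (x ** inv y)) -> forall x, gen S x -> Q x.
Proof.
  intros Q1 QS QV x Hx.
  assert (H : (forall y, Q y -> Q (y ** x)) /\ (forall y, Q y -> Q (y ** inv x))).
  { apply Hx.
    - repeat split.
      + intros y; now gsimp.
      + intros y; now gsimp.
      + destruct H, H0; intros z Hz; rewrite mulA; auto.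
      + destruct H, H0; intros z Hz; rewrite invM, mulA; auto.
      + apply H.
      + intros z; rewrite invK; apply H.
    - split; auto. }
  rewrite <- (mul1l x); now apply H.
Qed.

Definition span (s : list G) : G -> Prop := gen (fun y => In y s).
Definition fg (H : G -> Prop) : Prop := exists s, forall x, H x <-> span s x.
Definition join (A B : G -> Prop) : G -> Prop := gen (fun y => A y \/ B y).

Lemma span_sub s : sub (span s). Proof. apply gen_sub. Qed.

Lemma sub_ext H K : (forall x, H x <-> K x) -> sub K -> sub H.
Proof.
  intros E [h1 [h2 h3]]; repeat split; intros.
  - now apply E.
  - apply E, h2; now apply E.
  - apply E, h3; now apply E.
Qed.

Lemma fg_sub H : fg H -> sub H.
Proof. intros [s Hs]; eapply sub_ext; [exact Hs|apply span_sub]. Qed.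

Lemma span_fg s : fg (span s). Proof. exists s; tauto. Qed.

Lemma join_span A B s s' : (forall x, A x <-> span s x) -> (forall x, B x <-> span s' x) ->
  forall x, join A B x <-> span (s ++ s') x.
Proof.
  intros HA HB x; split; apply gen_min; try apply gen_sub.
  - intros y [Hy|Hy]; [apply HA in Hy|apply HB in Hy]; revert Hy; apply gen_min;
      try apply gen_sub; intros z Hz; apply gen_in, in_app_iff; auto.
  - intros y Hy; apply gen_in; apply in_app_iff in Hy as [Hy|Hy];
      [left; apply HA|right; apply HB]; now apply gen_in.
Qed.

Lemma join_fg A B : fg A -> fg B -> fg (join A B).
Proof. intros [s Hs] [s' Hs']; exists (s ++ s'); now apply join_span. Qed.

Lemma span_conj g s x : span (map (conjg g) s) x <-> span s (conjg (inv g) x).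
Proof.
  split.
  - apply (gen_min _ (fun x => span s (conjg (inv g) x))).
    + apply sub_conj, span_sub.
    + intros y Hy; apply in_map_iff in Hy as [z [<- Hz]].
      rewrite conjKV; now apply gen_in.
  - intros Hx. rewrite <- (conjK g x). revert Hx.
    apply (gen_min _ (fun y => span (map (conjg g) s) (conjg g y))).
    + apply sub_conj, span_sub.
    + intros y Hy; apply gen_in; now apply in_map.
Qed.

(** * Cosets, transversals and finite index *)

Definition covers (H U : G -> Prop) (l : list G) : Prop :=
  forall h, H h -> exists t, In t l /\ U (h ** inv t).
Definition scattered (U : G -> Prop) (l : list G) : Prop :=
  ForallOrdPairs (fun x y => ~ U (x ** inv y)) l.
(* A transversal of the right cosets of [H /\ U] in [H]; [U] need not lie in [H]. *)
Definition transversal (H U : G -> Prop) (l : list G) : Prop :=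
  (forall t, In t l -> H t) /\ covers H U l /\ scattered U l.
Definition full : G -> Prop := fun _ => True.
(** For a subgroup this means finite index. No distinctness is asked of the list, so the property
    passes to larger predicates at once. *)
Definition cofinite (U : G -> Prop) : Prop := exists l, covers full U l.
Definition fin_idx (U : G -> Prop) : Prop := sub U /\ cofinite U.

Lemma cofinite_mono (U V : G -> Prop) : (forall x, U x -> V x) -> cofinite U -> cofinite V.
Proof.
  intros UV [l Hl]; exists l; intros h Hh; destruct (Hl h Hh) as [t [Ht Ut]]; eauto.
Qed.

Lemma scattered_mono (U V : G -> Prop) l :
  (forall x, U x -> V x) -> scattered V l -> scattered U l.
Proof. intros UV; apply ForallOrdPairs_imp; intros x y H H'; auto. Qed.

(** Two elements of one coset [U z] have their quotient in [U], so the pigeonhole principle applies.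
    All comparisons of indices rest on this. *)
Lemma scattered_le_covers (H U : G -> Prop) s l : sub U ->
  scattered U s -> (forall x, In x s -> H x) -> covers H U l ->
  (length s <= length l)%nat.
Proof.
  intros sU Hs HH Hl; apply pigeonhole_rel with (R := fun x t => U (x ** inv t)).
  - eapply ForallOrdPairs_imp; [|exact Hs]; intros x y Hxy z Hx Hy; apply Hxy.
    replace (x ** inv y) with ((x ** inv z) ** inv (y ** inv z)) by now gsimp.
    apply sub_m; auto. now apply sub_v.
  - intros x Hx; apply Hl; auto.
Qed.

Lemma transversal_exists (H U : G -> Prop) : sub U ->
  (exists l, covers H U l) -> exists l, transversal H U l.
Proof.
  intros sU [l0 Hl0].
  destruct (cover_or_scattered G H (fun x t => U (x ** inv t)) (S (length l0)))
    as [[l [_ [H1 [H2 H3]]]]|[l [H1 [H2 H3]]]].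
  - now exists l.
  - pose proof (scattered_le_covers H U l l0 sU H3 H2 Hl0); lia.
Qed.

Lemma fin_idx_transversal H U : fin_idx U -> exists l, transversal H U l.
Proof.
  intros [sU [l Hl]]; apply transversal_exists; auto.
  exists l; intros h _; now apply Hl.
Qed.

Lemma transversal_mono (H H' U : G -> Prop) l l' : sub U -> (forall x, H' x -> H x) ->
  transversal H' U l' -> transversal H U l -> (length l' <= length l)%nat.
Proof.
  intros sU HH [T1 [T2 T3]] [T1' [T2' T3']].
  apply (scattered_le_covers H U); auto.
Qed.

(** If [H] is the union of the [K a] and [K] that of the [U t], then [H] is the union of the
    [U t a]; hence the order of the factors. *)
Definition prod_list (l1 l2 : list G) : list G :=
  flat_map (fun a => map (fun t => t ** a) l2) l1.

Lemma prod_list_length l1 l2 : length (prod_list l1 l2) = (length l1 * length l2)%nat.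
Proof.
  unfold prod_list; induction l1 as [|a l1 IH]; simpl; auto.
  now rewrite length_app, length_map, IH.
Qed.

Lemma in_prod_list l1 l2 x :
  In x (prod_list l1 l2) <-> exists a t, In a l1 /\ In t l2 /\ x = t ** a.
Proof.
  unfold prod_list; rewrite in_flat_map; split.
  - intros [a [Ha Hx]]; apply in_map_iff in Hx as [t [<- Ht]]; eauto 6.
  - intros [a [t [Ha [Ht ->]]]]; exists a; split; auto.
    apply in_map_iff; eauto.
Qed.

Lemma transversal_mul (H K U : G -> Prop) l1 l2 : sub H -> sub K -> sub U ->
  (forall x, U x -> K x) -> (forall x, K x -> H x) ->
  transversal H K l1 -> transversal K U l2 -> transversal H U (prod_list l1 l2).
Proof.
  intros sH sK sU UK KH [A1 [A2 A3]] [B1 [B2 B3]]; split; [|split].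
  - intros x Hx; apply in_prod_list in Hx as [a [t [Ha [Ht ->]]]].
    apply sub_m; auto.
  - intros h Hh; destruct (A2 h Hh) as [a [Ha Ka]].
    destruct (B2 _ Ka) as [t [Ht Ut]].
    exists (t ** a); split; [apply in_prod_list; eauto|].
    revert Ut; now gsimp.
  - clear A1 A2; induction A3 as [|a l1 Ha A3 IH]; simpl; [constructor|].
    apply ForallOrdPairs_app; auto.
    + apply ForallOrdPairs_map; eapply ForallOrdPairs_imp; [|exact B3].
      intros x y Hxy; now gsimp.
    + intros x y Hx Hy; apply in_map_iff in Hx as [t [<- Ht]].
      apply in_prod_list in Hy as [b [u [Hb [Hu ->]]]].
      intros HU; rewrite Forall_forall in Ha; apply (Ha b Hb).
      replace (a ** inv b) with (inv t ** (t ** a ** inv (u ** b)) ** u)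
        by (now gsimp).
      apply sub_m; auto; apply sub_m; auto. apply sub_v; auto.
Qed.

Lemma fin_idx_inter U V : fin_idx U -> fin_idx V -> fin_idx (fun x => U x /\ V x).
Proof.
  intros [sU cU] hV.
  assert (sUV : sub (fun x => U x /\ V x)) by (apply sub_inter; auto; apply hV).
  split; auto.
  destruct (transversal_exists full U sU cU) as [l1 T1].
  destruct (fin_idx_transversal U V hV) as [l2 [T2 [T3 T4]]].
  exists (prod_list l1 l2); intros h Hh.
  destruct T1 as [_ [T1 _]]; destruct (T1 h Hh) as [a [Ha Ua]].
  destruct (T3 _ Ua) as [t [Ht Vt]].
  exists (t ** a); split; [apply in_prod_list; eauto|].
  rewrite invM, mulA; split; auto.
  apply sub_m; auto; apply sub_v; auto.
Qed.

Lemma fin_idx_full : fin_idx full.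
Proof. split; [apply sub_full|exists (e :: nil); intros h _; exists e; split; [now left|exact I]]. Qed.

Lemma cofinite_conj g U : cofinite U -> cofinite (fun x => U (conjg g x)).
Proof.
  intros [l Hl]; exists (map (conjg (inv g)) l); intros h _.
  destruct (Hl (conjg g h) I) as [t [Ht Ut]].
  exists (conjg (inv g) t); split; [now apply in_map|].
  now rewrite conjM, conjV, conjK.
Qed.

Lemma fin_idx_conj g U : fin_idx U -> fin_idx (fun x => U (conjg g x)).
Proof. intros [sU cU]; split; [now apply sub_conj|now apply cofinite_conj]. Qed.

(** * Normal cores *)

Definition core (U : G -> Prop) : G -> Prop := fun x => forall g, U (conjg g x).

Lemma core_sub U : sub U -> sub (core U).
Proof.
  intros sU; repeat split.
  - intros g; rewrite conj1; now apply sub_e.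
  - intros x y Hx Hy g; rewrite conjM; apply sub_m; auto.
  - intros x Hx g; rewrite conjV; apply sub_v; auto.
Qed.

Lemma core_le U x : core U x -> U x.
Proof. intros H; specialize (H e); revert H; unfold conjg; now gsimp. Qed.

Lemma core_normal U g x : core U x -> core U (conjg g x).
Proof. intros H h; rewrite conj_comp; apply H. Qed.

(** Membership of [conjg g x] in [U] depends only on the coset [U g], so finitely many conjugates of
    [U] already intersect in the core. *)
Lemma fin_idx_core U : fin_idx U -> fin_idx (core U).
Proof.
  intros hU; pose proof hU as [sU [l Hl]].
  split; [now apply core_sub|].
  assert (hm : fin_idx (fun x => forall t, In t l -> U (conjg t x))).
  { clear Hl; induction l as [|a l IH].
    - destruct fin_idx_full as [s c]; split.
      + repeat split; intros; simpl in *; tauto.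
      + revert c; apply cofinite_mono; intros x _ t [].
    - pose proof (fin_idx_inter _ _ (fin_idx_conj a U hU) IH) as [s c]; split.
      + eapply sub_ext; [|exact s]; simpl; intros x; split.
        * intros H; split; intros; apply H; auto.
        * intros [H1 H2] t [<-|Ht]; auto.
      + revert c; apply cofinite_mono; simpl.
        intros x [H1 H2] t [<-|Ht]; auto. }
  destruct hm as [_ c]; revert c; apply cofinite_mono.
  intros x Hx g; destruct (Hl g I) as [t [Ht Ut]].
  replace (conjg g x) with ((g ** inv t) ** conjg t x ** inv (g ** inv t))
    by (unfold conjg; now gsimp).
  apply sub_m; auto; [apply sub_m; auto|now apply sub_v].
Qed.

(** * Schreier generators *)

Lemma transversal_with_unit H U l : sub H -> sub U -> transversal H U l ->
  exists l', transversal H U l' /\ In e l' /\ length l' = length l.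
Proof.
  intros sH sU [T1 [T2 T3]].
  destruct (T2 e (sub_e H sH)) as [t0 [Ht0 _]].
  exists (map (fun t => t ** inv t0) l); repeat split.
  - intros x Hx; apply in_map_iff in Hx as [t [<- Ht]].
    apply sub_m; auto; apply sub_v; auto.
  - intros h Hh. destruct (T2 (h ** t0)) as [t [Ht Ut]]; [apply sub_m; auto|].
    exists (t ** inv t0); split; [apply in_map_iff; eauto|].
    revert Ut; now gsimp.
  - apply ForallOrdPairs_map; eapply ForallOrdPairs_imp; [|exact T3].
    intros x y Hxy; now gsimp.
  - apply in_map_iff; exists t0; now gsimp.
  - apply length_map.
Qed.

Lemma scattered_eq U l x y : sub U -> scattered U l -> In x l -> In y l ->
  U (x ** inv y) -> x = y.
Proof.
  intros sU Hl; induction Hl as [|z l Hz Hl IH]; intros Hx Hy HU; [destruct Hx|].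
  rewrite Forall_forall in Hz.
  destruct Hx as [->|Hx], Hy as [->|Hy]; auto.
  - now destruct (Hz y Hy).
  - destruct (Hz x Hx).
    replace (y ** inv x) with (inv (x ** inv y)) by now gsimp.
    now apply sub_v.
Qed.

(** Schreier's lemma: the generators are [t ** a ** inv t'], where [a] is in [s] and [t'] represents
    the coset of [t ** a]. Every pair of [t] and [a] contributes one entry, so the length is exact
    and entries may repeat. *)
Lemma schreier s U l : sub U -> transversal (span s) U l ->
  exists s', length s' = (length l * length s)%nat /\
    forall x, (span s x /\ U x) <-> span s' x.
Proof.
  intros sU T0.
  destruct (transversal_with_unit _ U l (span_sub s) sU T0) as [l' [[T1 [T2 T3]] [T4 <-]]].
  clear T0 l; rename l' into l.
  destruct (Forall2_exists _ _
    (fun p y => exists t', In t' l /\ y = fst p ** snd p ** inv t' /\ U y)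
    (list_prod l s)) as [s' Hs'].
  { intros [t a] Hp; apply in_prod_iff in Hp as [Ht Ha]; simpl.
    destruct (T2 (t ** a)) as [t' [Ht' Ut']].
    - apply sub_m; [apply span_sub|auto|now apply gen_in].
    - eauto. }
  exists s'; split.
  { rewrite <- (Forall2_length Hs'); apply length_prod. }
  assert (sD := span_sub s').
  intros x; split.
  - intros [Hx Ux].
    (* The union of the cosets [span s' t], [t] in [l], contains [e] and is stable under right
       multiplication by the generators and their inverses. *)
    assert (Hc : span s x /\ exists t, In t l /\ span s' (x ** inv t)).
    { clear Ux; revert x Hx.
      apply gen_right_ind.
      - split; [apply sub_e, span_sub|]. exists e; split; auto.
        gsimp; now apply sub_e.
      - intros x a [Hx [t [Ht Dt]]] Ha.
        split; [apply sub_m; [apply span_sub|auto|now apply gen_in]|].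
        destruct (Forall2_in_l _ _ _ _ _ (t, a) Hs') as [y [Hy [t' [Ht' [-> _]]]]];
          [now apply in_prod|].
        exists t'; split; auto. simpl in Hy.
        replace (x ** a ** inv t') with ((x ** inv t) ** (t ** a ** inv t')) by now gsimp.
        apply sub_m; auto; now apply gen_in.
      - intros x a [Hx [t' [Ht' Dt]]] Ha.
        assert (Hxa : span s (x ** inv a)).
        { apply sub_m; [apply span_sub|auto|].
          apply sub_v; [apply span_sub|now apply gen_in]. }
        split; auto.
        destruct (T2 (t' ** inv a)) as [t [Ht Ut]].
        { apply sub_m; [apply span_sub|auto|].
          apply sub_v; [apply span_sub|now apply gen_in]. }
        exists t; split; auto.
        destruct (Forall2_in_l _ _ _ _ _ (t, a) Hs') as [y [Hy [t'' [Ht'' [-> Uy]]]]];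
          [now apply in_prod|].
        simpl in Hy, Uy.
        (* As [t] represents the coset of [t' ** inv a], the coset of [t ** a] is that of [t']. *)
        assert (t' = t'') as <-.
        { apply (scattered_eq U l); auto.
          replace (t' ** inv t'')
            with ((t' ** inv a ** inv t) ** (t ** a ** inv t'')) by now gsimp.
          now apply sub_m. }
        replace (x ** inv a ** inv t)
          with ((x ** inv t') ** inv (t ** a ** inv t')) by now gsimp.
        apply sub_m; auto; apply sub_v; auto; now apply gen_in. }
    destruct Hc as [_ [t [Ht Dt]]].
    assert (s'U : forall y, span s' y -> U y).
    { intros y; apply gen_min; auto. intros z Hz.
      destruct (Forall2_in_r _ _ _ _ _ z Hs' Hz) as [p [_ [t' H]]]; apply H. }
    (* Both [x] and [x ** inv t] lie in [U], so [t] represents the coset [U], as [e] does. *)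
    assert (e = t) as <-.
    { apply (scattered_eq U l); auto.
      replace (e ** inv t) with (inv x ** (x ** inv t)) by now gsimp.
      apply sub_m; auto; now apply sub_v. }
    revert Dt; now gsimp.
  - apply (gen_min _ (fun x => span s x /\ U x)).
    { apply sub_inter; auto; apply span_sub. }
    intros z Hz.
    destruct (Forall2_in_r _ _ _ _ _ z Hs' Hz) as [[t a] [Hp [t' [Ht' [-> HU]]]]].
    apply in_prod_iff in Hp as [Ht Ha]; simpl in *; split; auto.
    assert (sS := span_sub s).
    apply sub_m; auto; [apply sub_m; auto; now apply gen_in|apply sub_v; auto].
Qed.

Lemma fg_inter_fin_idx H U : fg H -> fin_idx U -> fg (fun x => H x /\ U x).
Proof.
  intros [s Hs] hU; destruct (fin_idx_transversal (span s) U hU) as [l Hl].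
  destruct (schreier s U l (proj1 hU) Hl) as [s' [_ Hs']].
  exists s'; intros x; rewrite <- Hs', Hs; tauto.
Qed.

Lemma fg_conj g H : fg H -> fg (fun x => H (conjg g x)).
Proof.
  intros [s Hs]; exists (map (conjg (inv g)) s); intros x.
  now rewrite span_conj, invK, Hs.
Qed.

(** * Indices, generating lists and countability *)

Lemma index_eq_transversal U l : sub U -> transversal full U l ->
  index_eq G mul e inv U (length l).
Proof.
  intros sU [_ [T2 T3]]; exists l; repeat split.
  - intros g; now apply T2.
  - intros i j Hi Hj HU.
    destruct (lt_eq_lt_dec i j) as [[Hij|Hij]|Hij]; auto.
    + now destruct (ForallOrdPairs_nth _ _ l e i j T3 (conj Hij Hj)).
    + destruct (ForallOrdPairs_nth _ _ l e j i T3 (conj Hij Hi)).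
      replace (nth j l e ** inv (nth i l e))
        with (inv (nth i l e ** inv (nth j l e))) by now gsimp.
      now apply sub_v.
Qed.

Lemma index_eq_cofinite U : sub U ->
  (exists n, index_eq G mul e inv U n) <-> cofinite U.
Proof.
  intros sU; split.
  - intros [n [l [_ [Hl _]]]]; exists l; intros g _; apply Hl.
  - intros cU; destruct (transversal_exists full U sU cU) as [l Hl].
    exists (length l); now apply index_eq_transversal.
Qed.

(** [generated_by_list] demands distinct entries, while lists of Schreier generators may repeat. *)
Lemma generated_by_refinement U s : (forall x, U x <-> span s x) ->
  exists s', generated_by_list G mul e inv U s' /\ (length s' <= length s)%nat.
Proof.
  intros Hs; destruct (NoDup_refinement G s) as [s' [H1 [H2 H3]]].
  exists s'; split; auto; split; [auto|split].
  - intros y Hy; apply Hs, gen_in; now apply H2.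
  - intros x; rewrite Hs; split; apply gen_min; try apply gen_sub;
      intros y Hy; apply gen_in; now apply H2.
Qed.

Lemma countable_group : fg full -> exists f : nat -> G, forall g, exists n, f n = g.
Proof.
  intros [s Hs]; destruct list_nat_enum as [dec Hdec].
  (* A letter is a position among the generators and their inverses; positions out of range read as
     [e]. The head of a word is its rightmost factor, to suit [gen_right_ind]. *)
  set (ev := fix ev (w : list nat) : G := match w with
       | nil => e | n :: w => ev w ** nth n (s ++ map inv s) e end).
  exists (fun n => ev (dec n)); intros g.
  assert (H : exists w, ev w = g).
  { assert (Hg : span s g) by now apply Hs.
    assert (step : forall x y, (exists w, ev w = x) -> In y (s ++ map inv s) ->
                     exists w, ev w = x ** y).
    { intros x y [w <-] Hy; apply In_nth with (d := e) in Hy as [n [_ <-]].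
      now exists (n :: w). }
    revert g Hg; apply gen_right_ind.
    - now exists nil.
    - intros x y Hx Hy; apply step; auto; apply in_app_iff; auto.
    - intros x y Hx Hy; apply step; auto; apply in_app_iff; right; now apply in_map. }
  destruct H as [w <-]; destruct (Hdec w) as [n <-]; now exists n.
Qed.

(** * Rank gradient and separability *)

(** Take for [c] the rank gradient: if [U] has index [n] and rank [d], then [d >= c n + 1], and
    every generating list has at least [d] entries. This form speaks of arbitrary lists, so minimal
    ones do not occur below. *)
Lemma rank_gradient_bound : (exists r, rank_gradient_is G mul e inv r /\ 0 < r) ->
  exists c, 0 < c /\ forall U s l, (forall x, U x <-> span s x) ->
    transversal full U l -> c * INR (length l) <= INR (length s).
Proof.
  intros [r [[Hr _] Hr0]]; exists r; split; auto.
  intros U s l Hs Hl.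
  assert (sU : sub U) by (eapply sub_ext; [exact Hs|apply span_sub]).
  assert (Hidx := index_eq_transversal U l sU Hl).
  destruct (generated_by_refinement U s Hs) as [s' [Hs' Hlen]].
  assert (Hmin : exists d, min_gen_card G mul e inv U d /\ (d <= length s')%nat).
  { destruct (dec_inh_nat_subset_has_unique_least_element
      (fun n => exists t, generated_by_list G mul e inv U t /\ length t = n))
      as [d [[Hd1 Hd2] _]].
    - intros n; apply classic.
    - exists (length s'), s'; auto.
    - exists d; split; [split; auto|]; [|apply Hd2; eauto].
      intros t Ht; apply Hd2; eauto. }
  destruct Hmin as [d [Hd Hds]].
  assert (Hpos : 0 < INR (length l)).
  { apply lt_0_INR. destruct Hl as [_ [Hl _]].
    destruct (Hl e I) as [t [Ht _]]; destruct l; [destruct Ht|simpl; lia]. }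
  assert (H : r <= (INR d - 1) / INR (length l)).
  { apply Hr; exists U, d, (length l); repeat split; auto; eauto; try apply sU;
      try apply Hd. }
  apply (Rmult_le_compat_r (INR (length l))) in H; [|lra].
  unfold Rdiv in H; rewrite Rmult_assoc, Rinv_l, Rmult_1_r in H by lra.
  assert (INR d <= INR (length s)) by (apply le_INR; lia).
  lra.
Qed.

(** * Separation by subgroups of finite index *)

Context (HLERF : LERF G mul e inv).

Lemma separate_list A F : fg A -> (forall x, In x F -> ~ A x) ->
  exists U, fin_idx U /\ (forall x, A x -> U x) /\ (forall x, In x F -> ~ U x).
Proof.
  intros hA; induction F as [|x F IH]; intros HF.
  - exists full; split; [apply fin_idx_full|split; [intros; exact I|intros x []]].
  - destruct IH as [U [hU [AU FU]]]; [intros y Hy; apply HF; now right|].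
    assert (hA' : fin_gen_subgroup G mul e inv A).
    { split; [now apply fg_sub|]. destruct hA as [s Hs].
      destruct (generated_by_refinement A s Hs) as [s' [Hs' _]]; eauto. }
    assert (HK : exists K, fin_idx K /\ (forall y, A y -> K y) /\ ~ K x).
    { apply NNPP; intros HN; apply (HF x (or_introl eq_refl)).
      apply (HLERF A hA'); intros K [sK iK] AK.
      apply NNPP; intros Kx; apply HN; exists K; repeat split; auto; try apply sK.
      now apply (index_eq_cofinite K sK). }
    destruct HK as [K [hK [AK Kx]]].
    exists (fun y => U y /\ K y); split; [now apply fin_idx_inter|split; auto].
    intros y [<-|Hy] [Uy Ky]; [auto|now apply (FU y)].
Qed.

(** Being scattered modulo [A] means that [A] avoids finitely many quotients [x ** inv y], which [U]
    can be made to avoid as well. *)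
Lemma separate_scattered A l : fg A -> scattered A l ->
  exists U, fin_idx U /\ (forall x, A x -> U x) /\ scattered U l.
Proof.
  intros hA Hl; induction Hl as [|x l Hx Hl [U [hU [AU Ul]]]].
  - exists full; split; [apply fin_idx_full|split; [intros; exact I|constructor]].
  - destruct (separate_list A (map (fun y => x ** inv y) l) hA) as [V [hV [AV lV]]].
    { intros z Hz; apply in_map_iff in Hz as [y [<- Hy]].
      rewrite Forall_forall in Hx; auto. }
    exists (fun y => U y /\ V y); split; [now apply fin_idx_inter|split; auto].
    constructor.
    + apply Forall_forall; intros y Hy [_ Vy]; revert Vy; apply lV.
      apply in_map_iff; eauto.
    + apply (scattered_mono (fun y => U y /\ V y) U); [tauto|exact Ul].
Qed.

(** Infinite index gives [n] elements scattered modulo [A]; they remain scattered modulo some [U] of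
    finite index, which then has at least [n] cosets. *)
Lemma large_index_overgroup A n : fg A -> ~ cofinite A ->
  exists U l, fin_idx U /\ (forall x, A x -> U x) /\
    transversal full U l /\ (n <= length l)%nat.
Proof.
  intros hA iA.
  destruct (cover_or_scattered G full (fun x t => A (x ** inv t)) n)
    as [[l [_ [_ [_ H]]]]|[s [Hn [_ Hs]]]].
  - destruct iA; now exists l.
  - destruct (separate_scattered A s hA Hs) as [U [hU [AU sU]]].
    destruct (fin_idx_transversal full U hU) as [l Hl].
    exists U, l; repeat split; auto; try apply hU; try apply Hl.
    rewrite <- Hn; apply (scattered_le_covers full U); try apply hU; auto.
    + intros; exact I.
    + apply Hl.
Qed.

(** * Enlarging a subgroup while its index stays infinite *)

Context (c : R) (c_pos : 0 < c).
Context (rank_bound : forall U s l, (forall x, U x <-> span s x) ->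
  transversal full U l -> c * INR (length l) <= INR (length s)).

Lemma archimedean_nat (x : R) : exists n : nat, x < INR n.
Proof.
  destruct (INR_archimed 1 x) as [n Hn]; [lra|].
  exists n; lra.
Qed.

(** Let k = [G:K], q = [K:U], b = |sb|. The join lies in [U], so if its index is finite it is at
    least kq; by Schreier |sc| + qb elements generate it. Hence (ck - b)q <= |sc|, which fails for
    large q. *)
Lemma adjoin_small K lk sb C : fin_idx K -> transversal full K lk ->
  (forall b, In b sb -> K b) -> INR (length sb) < c * INR (length lk) ->
  fg C -> (forall x, C x -> K x) -> ~ cofinite C ->
  exists U, fin_idx U /\ ~ cofinite (join C (fun y => span sb y /\ U y)).
Proof.
  intros hK Tk sbK Hlt hC CK iC.
  pose proof hC as [sc Hsc].
  set (k := INR (length lk)) in *; set (b := INR (length sb)) in *.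
  (* Since kq = [G:U] >= [G:U0] >= n, this [n] makes q exceed |sc| / (ck - b). *)
  destruct (archimedean_nat (k * (INR (length sc) / (c * k - b)))) as [n Hn].
  destruct (large_index_overgroup C n hC iC) as [U0 [l0 [hU0 [CU0 [T0 Hl0]]]]].
  set (U := fun x => U0 x /\ K x).
  assert (hU : fin_idx U) by now apply fin_idx_inter.
  exists U; split; auto; intros cJ.
  set (J := join C (fun y => span sb y /\ U y)) in *.
  destruct (fin_idx_transversal K U hU) as [lq Tq].
  assert (T : transversal full U (prod_list lk lq)).
  { apply (transversal_mul full K); auto; try apply sub_full; try apply hK;
      try apply hU; [intros x [_ Hx]; auto|intros; exact I]. }
  destruct (fin_idx_transversal (span sb) U hU) as [lb Tb].
  assert (Hlb : (length lb <= length lq)%nat).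
  { apply (transversal_mono K (span sb) U); auto; [apply hU|].
    intros x; apply gen_min; auto; apply hK. }
  destruct (schreier sb U lb (proj1 hU) Tb) as [sb' [Hsb' Esb']].
  assert (EJ : forall x, J x <-> span (sc ++ sb') x) by now apply join_span.
  assert (sJ : sub J) by apply gen_sub.
  destruct (transversal_exists full J sJ cJ) as [lj Tj].
  assert (JU : forall x, J x -> U x).
  { intros x; apply gen_min; [apply hU|]. intros y [Hy|[_ Hy]]; auto; split; auto. }
  assert (H1 : (length (prod_list lk lq) <= length lj)%nat).
  { apply (scattered_le_covers full J); auto; [|intros; exact I|apply Tj].
    apply (scattered_mono J U); auto; apply T. }
  assert (H2 : (length l0 <= length (prod_list lk lq))%nat).
  { apply (scattered_le_covers full U); auto; [apply hU| |intros; exact I|apply T].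
    apply (scattered_mono U U0); [intros x [Hx _]; auto|apply T0]. }
  rewrite prod_list_length in H1, H2.
  pose proof (rank_bound J _ lj EJ Tj) as H3.
  rewrite length_app, Hsb', plus_INR, mult_INR in H3.
  apply le_INR in H1, Hlb.
  assert (H4 : INR n <= INR (length lk * length lq)) by (apply le_INR; lia).
  rewrite mult_INR in H1, H4; fold k in H1, H4; fold b in H3.
  set (q := INR (length lq)) in *.
  assert (Hb : 0 <= b) by apply pos_INR.
  assert (Hq : 0 <= q) by apply pos_INR.
  assert (Hk : 0 < k) by nra.
  assert (H5 : (c * k - b) * q <= INR (length sc)) by nra.
  assert (H6 : INR (length sc) / (c * k - b) < q).
  { apply (Rmult_lt_reg_l k); lra. }
  apply (Rmult_lt_compat_l (c * k - b)) in H6; [|lra].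
  replace ((c * k - b) * (INR (length sc) / (c * k - b)))
    with (INR (length sc)) in H6 by (field; lra).
  lra.
Qed.

(** Induction on [ts]: as [K] is normal, the conjugate of [sb] by [t] is a list of the same length
    in [K], so it can be adjoined to the subgroup reached so far. *)
Lemma adjoin_small_conjugates K lk sb C ts : fin_idx K ->
  (forall g x, K x -> K (conjg g x)) -> transversal full K lk ->
  (forall b, In b sb -> K b) -> INR (length sb) < c * INR (length lk) ->
  fg C -> (forall x, C x -> K x) -> ~ cofinite C ->
  exists D U, fg D /\ (forall x, D x -> K x) /\ ~ cofinite D /\
    (forall x, C x -> D x) /\ fin_idx U /\
    (forall t y, In t ts -> span sb y -> U y -> D (conjg t y)).
Proof.
  intros hK nK Tk sbK Hlt hC CK iC; induction ts as [|t ts IH].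
  - exists C, full; repeat (split; auto); try apply fin_idx_full.
    intros t y [].
  - destruct IH as [D [U [hD [DK [iD [CD [hU HU]]]]]]].
    destruct (adjoin_small K lk (map (conjg t) sb) D) as [V [hV HV]]; auto.
    { intros b Hb; apply in_map_iff in Hb as [a [<- Ha]]; auto. }
    { now rewrite length_map. }
    exists (join D (fun y => span (map (conjg t) sb) y /\ V y)).
    exists (fun y => U y /\ V (conjg t y)).
    split; [|split; [|split; [auto|split; [|split]]]].
    + apply join_fg; auto. apply fg_inter_fin_idx; auto; apply span_fg.
    + intros x; apply gen_min; [apply hK|]. intros y [Hy|[Hy _]]; auto.
      revert Hy; apply gen_min; [apply hK|].
      intros b Hb; apply in_map_iff in Hb as [a [<- Ha]]; auto.
    + intros x Hx; apply gen_in; left; auto.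
    + apply fin_idx_inter; auto; now apply fin_idx_conj.
    + intros t' y [<-|Ht'] Hy [Uy Vy]; apply gen_in.
      * right; split; auto. apply span_conj; now rewrite conjKV.
      * left; auto.
Qed.

(** [D] absorbs [A /\ K] and a part of each conjugate of [B /\ K] by the representatives [ts] of [A]
    modulo [K]. The join then lies in finitely many cosets [D t], so its finite index would pass to
    [D]. *)
Lemma adjoin_fin_idx_part A B : fg A -> ~ cofinite A -> fg B -> ~ cofinite B ->
  exists U, fin_idx U /\ ~ cofinite (join A (fun y => B y /\ U y)).
Proof.
  intros hA iA hB iB; pose proof hB as [sb Hsb].
  (* This gives |sb| < c [G:V]. Passing to [K] multiplies [G:V] by [V:K] and, by Schreier, the
     number of generators by at most [V:K], so the inequality persists. *)
  destruct (archimedean_nat (INR (length sb) / c)) as [n Hn].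
  destruct (large_index_overgroup B n hB iB) as [V [lv [hV [BV [Tv Hlv]]]]].
  set (K := core V).
  assert (hK : fin_idx K) by now apply fin_idx_core.
  destruct (fin_idx_transversal V K hK) as [lw Tw].
  assert (Tk : transversal full K (prod_list lv lw)).
  { apply (transversal_mul full V); auto; try apply sub_full; try apply hK;
      try apply hV; [apply core_le|intros; exact I]. }
  destruct (fin_idx_transversal (span sb) K hK) as [lb Tb].
  assert (Hlb : (length lb <= length lw)%nat).
  { apply (transversal_mono V (span sb) K); auto; [apply hK|].
    intros x Hx; apply BV; now apply Hsb. }
  destruct (schreier sb K lb (proj1 hK) Tb) as [sb' [Hsb' Esb']].
  destruct (fin_idx_transversal A K hK) as [ts Tt].
  destruct (adjoin_small_conjugates K (prod_list lv lw) sb' (fun x => A x /\ K x) ts)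
    as [D [U [hD [DK [iD [CD [hU HU]]]]]]]; auto.
  - intros g x; apply core_normal.
  - intros b Hb; apply Esb'; now apply gen_in.
  - rewrite Hsb', prod_list_length, !mult_INR.
    apply le_INR in Hlb, Hlv.
    assert (Hw : 0 < INR (length lw)).
    { apply lt_0_INR; destruct Tw as [_ [Tw _]].
      destruct (Tw e (sub_e V (proj1 hV))) as [t [Ht _]].
      destruct lw; [destruct Ht|simpl; lia]. }
    assert (Hs : 0 <= INR (length sb)) by apply pos_INR.
    assert (H1 : INR (length sb) < c * INR (length lv)).
    { apply (Rmult_lt_reg_r (/ c)); [now apply Rinv_0_lt_compat|].
      replace (c * INR (length lv) * / c) with (INR (length lv)) by (field; lra).
      unfold Rdiv in Hn; lra. }
    apply Rle_lt_trans with (INR (length lw) * INR (length sb)); [nra|].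
    replace (c * (INR (length lv) * INR (length lw)))
      with (INR (length lw) * (c * INR (length lv))) by ring.
    now apply Rmult_lt_compat_l.
  - now apply fg_inter_fin_idx.
  - simpl; tauto.
  - intros H; apply iA; revert H; apply cofinite_mono; tauto.
  - exists (fun y => U y /\ K y); split; [now apply fin_idx_inter|].
    intros [l Hl]; apply iD.
    (* The finite union of cosets [D t], [t] in [ts], is stable under right
       multiplication by [A] and by [B /\ U /\ K]. *)
    assert (sA := fg_sub A hA); assert (sD := fg_sub D hD).
    destruct Tt as [Tt1 [Tt2 _]].
    assert (HQ : forall x, join A (fun y => B y /\ U y /\ K y) x ->
                   exists t, In t ts /\ D (x ** inv t)).
    { assert (HA : forall x y, (exists t, In t ts /\ D (x ** inv t)) -> A y ->
                     exists t, In t ts /\ D (x ** y ** inv t)).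
      { intros x y [t [Ht Dt]] Ay.
        assert (Aty : A (t ** y)) by (apply sub_m; auto).
        destruct (Tt2 _ Aty) as [t' [Ht' Kt']].
        exists t'; split; auto.
        replace (x ** y ** inv t') with ((x ** inv t) ** (t ** y ** inv t'))
          by now gsimp.
        apply sub_m; auto; apply CD; split; auto.
        apply sub_m; auto; apply sub_v; auto. }
      assert (HB : forall x y, (exists t, In t ts /\ D (x ** inv t)) ->
                     B y -> U y -> K y -> exists t, In t ts /\ D (x ** y ** inv t)).
      { intros x y [t [Ht Dt]] By Uy Ky; exists t; split; auto.
        replace (x ** y ** inv t) with ((x ** inv t) ** conjg t y)
          by (unfold conjg; now gsimp).
        apply sub_m; auto; apply HU; auto.
        apply (proj1 (Esb' y)); split; auto; now apply Hsb. }
      apply gen_right_ind.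
      - destruct (Tt2 e (sub_e A sA)) as [t [Ht Kt]]; exists t; split; auto.
        apply CD; split; auto.
        apply sub_m; auto; [now apply sub_e|apply sub_v; auto].
      - intros x y Hx [Hy|[By [Uy Ky]]]; auto.
      - intros x y Hx [Hy|[By [Uy Ky]]].
        + apply HA; auto; now apply sub_v.
        + apply HB; auto; apply sub_v; auto; try apply hU; try apply hK.
          now apply fg_sub. }
    exists (prod_list l ts); intros g _.
    destruct (Hl g I) as [a [Ha Ja]]; destruct (HQ _ Ja) as [t [Ht Dt]].
    exists (t ** a); split; [apply in_prod_list; eauto|].
    revert Dt; now gsimp.
Qed.

(** * The size of normal subgroups inside a subgroup of infinite index *)

Context (sg : list G) (Hsg : forall x, span sg x).

(** Let u = [G:U], q = [U:W], p = [G:P], r = [P:W], a = |sa|. Then pr = uq and r >= m, while qa + pd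
    elements suffice to generate [W], so cuq <= qa + pd. Multiplying by m gives (cm - d)u <= am,
    which fails for large u if cm > d. *)
Lemma normal_part_bounded A s : fg A -> ~ cofinite A -> NoDup s ->
  (forall x, In x s -> core A x) -> c * INR (length s) <= INR (length sg).
Proof.
  intros hA iA Ns sM; pose proof hA as [sa Hsa].
  apply Rnot_lt_le; intros Hlt.
  set (M := core A) in *; set (m := INR (length s)) in *; set (d := INR (length sg)) in *.
  assert (sA := fg_sub A hA).
  assert (sMs : sub M) by now apply core_sub.
  (* Distinct elements are scattered modulo the trivial subgroup, so they can be kept in distinct
     cosets of some [W'] of finite index. *)
  destruct (separate_scattered (span nil) s (span_fg nil)) as [W' [hW' [_ sW']]].
  { apply NoDup_ForallOrdPairs in Ns; eapply ForallOrdPairs_imp; [|exact Ns].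
    intros x y Hxy Hs; apply Hxy.
    assert (E : x ** inv y = e).
    { revert Hs; apply (gen_min _ (fun z => z = e)); [|intros z []].
      repeat split; intros; subst; now gsimp. }
    rewrite <- (mulKl x y), E; apply mul1l. }
  destruct (archimedean_nat (INR (length sa) * m / (c * m - d))) as [n Hn].
  destruct (large_index_overgroup A n hA iA) as [U [lu [hU [AU [Tu Hlu]]]]].
  set (W := fun x => U x /\ W' x).
  assert (hW : fin_idx W) by now apply fin_idx_inter.
  pose proof (proj1 hW) as sW.
  destruct (fin_idx_transversal U W hW) as [lq Tq].
  assert (TW : transversal full W (prod_list lu lq)).
  { apply (transversal_mul full U); auto; try apply sub_full; try apply hU;
      [intros x [Hx _]; auto|intros; exact I]. }
  (* The product [M W] is a subgroup because [M] is normal; it contains [s], whence r >= m. *)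
  set (P := fun y => exists a w, M a /\ W w /\ y = a ** w).
  assert (WP : forall x, W x -> P x).
  { intros x Hx; exists e, x; repeat split; try apply Hx; [now apply sub_e|now gsimp]. }
  assert (sP : sub P).
  { repeat split.
    - now apply WP, sub_e.
    - intros x y [a [w [Ha [Hw ->]]]] [a' [w' [Ha' [Hw' ->]]]].
      exists (a ** conjg w a'), (w ** w'); split; [|split].
      + apply sub_m; auto; now apply core_normal.
      + now apply sub_m.
      + unfold conjg; now gsimp.
    - intros x [a [w [Ha [Hw ->]]]].
      exists (conjg (inv w) (inv a)), (inv w); split; [|split].
      + apply core_normal; now apply sub_v.
      + now apply sub_v.
      + unfold conjg; now gsimp. }
  assert (hP : fin_idx P) by (split; auto; eapply cofinite_mono; [exact WP|apply hW]).
  destruct (fin_idx_transversal full P hP) as [lp Tp].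
  destruct (fin_idx_transversal P W hW) as [lr Tr].
  assert (TW' : transversal full W (prod_list lp lr)).
  { apply (transversal_mul full P); auto; try apply sub_full; intros; exact I. }
  assert (Hs : (length s <= length lr)%nat).
  { apply (scattered_le_covers P W); auto; [| |apply Tr].
    - apply (scattered_mono W W'); auto; intros x [_ Hx]; auto.
    - intros x Hx; exists x, e; split; [now apply sM|split; [now apply sub_e|now gsimp]]. }
  assert (Tp' : transversal (span sg) P lp).
  { split; [intros; apply Hsg|split; [intros h _; now apply Tp|apply Tp]]. }
  destruct (schreier sg P lp sP Tp') as [sp [Hsp Esp]].
  (* Each Schreier generator of [P] is replaced by an element of [W] congruent to it modulo [M]. *)
  destruct (Forall2_exists _ _ (fun p w => W w /\ exists a, M a /\ p = a ** w) sp)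
    as [sw Hsw].
  { intros p Hp; assert (HP : P p) by (apply Esp; now apply gen_in).
    destruct HP as [a [w [Ha [Hw ->]]]]; eauto. }
  destruct (fin_idx_transversal (span sa) W hW) as [la Ta].
  destruct (schreier sa W la sW Ta) as [sa' [Hsa' Esa']].
  set (D := span (sa' ++ sw)).
  assert (sD : sub D) by apply span_sub.
  assert (DW : forall x, D x -> W x).
  { intros x; apply gen_min; auto; intros y Hy; apply in_app_iff in Hy as [Hy|Hy].
    - apply Esa'; now apply gen_in.
    - destruct (Forall2_in_r _ _ _ _ _ y Hsw Hy) as [p [_ [Hw _]]]; auto. }
  assert (HPD : forall y, span sp y -> exists a w, M a /\ D w /\ y = a ** w).
  { apply gen_right_ind.
    - exists e, e; split; [now apply sub_e|split; [now apply sub_e|now gsimp]].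
    - intros x y [a [w [Ha [Hw ->]]]] Hy.
      destruct (Forall2_in_l _ _ _ _ _ y Hsw Hy) as [w' [Hw' [_ [a' [Ha' ->]]]]].
      exists (a ** conjg w a'), (w ** w'); split; [|split].
      + apply sub_m; auto; now apply core_normal.
      + apply sub_m; auto; apply gen_in, in_app_iff; auto.
      + unfold conjg; now gsimp.
    - intros x y [a [w [Ha [Hw ->]]]] Hy.
      destruct (Forall2_in_l _ _ _ _ _ y Hsw Hy) as [w' [Hw' [_ [a' [Ha' ->]]]]].
      exists (a ** conjg (w ** inv w') (inv a')), (w ** inv w'); split; [|split].
      + apply sub_m; auto; apply core_normal; now apply sub_v.
      + apply sub_m; auto; apply sub_v; auto; apply gen_in, in_app_iff; auto.
      + unfold conjg; now gsimp. }
  (* Write [x] as [a ** w] with [w] in [D]. Then [a] lies in [M] and in [W], hence in [A /\ W],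
     which [sa'] generates. *)
  assert (ED : forall x, W x <-> D x).
  { intros x; split; auto; intros Wx.
    destruct (HPD x) as [a [w [Ha [Hw ->]]]].
    { apply (proj1 (Esp _)); split; [apply Hsg|now apply WP]. }
    apply sub_m; auto.
    assert (Haw : span sa' a).
    { apply (proj1 (Esa' a)); split; [apply Hsa; now apply core_le|].
      replace a with (a ** w ** inv w) by now gsimp.
      apply sub_m; auto; apply sub_v; auto. }
    revert Haw; apply gen_min; auto; intros z Hz; apply gen_in, in_app_iff; auto. }
  pose proof (rank_bound W _ _ ED TW) as HR.
  assert (Hla : (length la <= length lq)%nat).
  { apply (transversal_mono U (span sa) W); auto.
    intros x Hx; apply AU; now apply Hsa. }
  assert (Heq : length (prod_list lu lq) = length (prod_list lp lr)).
  { apply Nat.le_antisymm; eapply (transversal_mono full full W); eauto. }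
  rewrite length_app, Hsa', <- (Forall2_length Hsw), Hsp, prod_list_length in HR.
  rewrite !prod_list_length in Heq; apply (f_equal INR) in Heq.
  rewrite plus_INR, !mult_INR in HR; rewrite !mult_INR in Heq.
  apply le_INR in Hla, Hs, Hlu; fold m in Hs; fold d in HR.
  assert (Hq : 0 < INR (length lq)).
  { apply lt_0_INR; destruct Tq as [_ [Tq _]].
    destruct (Tq e (sub_e U (proj1 hU))) as [t [Ht _]].
    destruct lq; [destruct Ht|simpl; lia]. }
  set (q := INR (length lq)) in *; set (p := INR (length lp)) in *;
    set (r := INR (length lr)) in *; set (u := INR (length lu)) in *;
    set (a := INR (length sa)) in *.
  assert (Hd : 0 <= d) by apply pos_INR.
  assert (Hp : 0 <= p) by apply pos_INR.
  assert (Hu : 0 <= u) by apply pos_INR.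
  assert (Ha : 0 <= a) by apply pos_INR.
  assert (Hm : 0 <= m) by apply pos_INR.
  assert (E1 : p * m <= u * q) by nra.
  assert (E2 : c * (u * q) <= q * a + p * d) by nra.
  assert (E3 : c * (u * q) * m <= q * a * m + (u * q) * d).
  { apply Rle_trans with ((q * a + p * d) * m); [nra|].
    assert (p * m * d <= u * q * d) by nra. lra. }
  assert (E4 : (c * m - d) * u <= a * m).
  { apply (Rmult_le_reg_l q); auto. lra. }
  assert (E5 : a * m / (c * m - d) < u) by lra.
  apply (Rmult_lt_compat_l (c * m - d)) in E5; [|lra].
  replace ((c * m - d) * (a * m / (c * m - d))) with (a * m) in E5 by (field; lra).
  lra.
Qed.

(** The empty list generates this subgroup, so the rank bound would make [c] times its index at most
    0. It is the first stage of the chain. *)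
Lemma trivial_not_cofinite : ~ cofinite (span nil).
Proof.
  intros H; destruct (transversal_exists full _ (span_sub nil) H) as [l Hl].
  pose proof (rank_bound (span nil) nil l (fun x => iff_refl _) Hl) as HR; simpl in HR.
  assert (0 < INR (length l)).
  { apply lt_0_INR; destruct Hl as [_ [Hl _]].
    destruct (Hl e I) as [t [Ht _]]; destruct l; [destruct Ht|simpl; lia]. }
  nra.
Qed.

(** * The stabilizer *)

(* A stage pairs a finitely generated subgroup of infinite index with a list of
   elements that this and all later stages must avoid. *)
Definition good_stage (st : (G -> Prop) * list G) : Prop :=
  fg (fst st) /\ ~ cofinite (fst st) /\ forall x, In x (snd st) -> ~ fst st x.

(* The word [g :: l] encodes two requests: to absorb a finite index part of the
   conjugate by [g] of the span of [l], and to keep [g :: l] out of the core. *)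
Definition stage_step (w : list G) (st st' : (G -> Prop) * list G) : Prop :=
  (forall x, fst st x -> fst st' x) /\
  (forall x, In x (snd st) -> In x (snd st')) /\
  (~ cofinite (span (tl w)) -> exists U, fin_idx U /\
     forall y, span (tl w) y -> U (conjg (hd e w) y) -> fst st' (conjg (hd e w) y)) /\
  (NoDup w -> INR (length sg) < c * INR (length w) ->
     exists x y, In y w /\ In (conjg x y) (snd st')).

(** If some entry of [w] is outside the core of [A], one of its conjugates is outside [A] and gets
    forbidden; [normal_part_bounded] ensures this for long [w]. Intersecting the adjoined part with
    a finite index [V] that contains [A] and avoids the forbidden list keeps the join inside [V]. *)
Lemma stage_step_exists w st : good_stage st ->
  exists st', good_stage st' /\ stage_step w st st'.
Proof.
  destruct st as [A F]; intros [hA [iA HF]]; simpl in *.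
  assert (H1 : exists F', (forall x, In x F -> In x F') /\
    (forall x, In x F' -> ~ A x) /\
    (NoDup w -> INR (length sg) < c * INR (length w) ->
       exists x y, In y w /\ In (conjg x y) F')).
  { destruct (classic (forall y, In y w -> core A y)) as [H|H].
    - exists F; repeat split; auto; intros Nw Hw.
      pose proof (normal_part_bounded A w hA iA Nw H); lra.
    - apply not_all_ex_not in H as [y H]; apply imply_to_and in H as [Hy H].
      apply not_all_ex_not in H as [x H].
      exists (conjg x y :: F); repeat split.
      + intros z Hz; now right.
      + intros z [<-|Hz]; auto.
      + intros _ _; exists x, y; split; simpl; auto. }
  destruct H1 as [F' [FF' [HF' HN]]].
  destruct (classic (cofinite (span (tl w)))) as [Hc|Hc].
  { exists (A, F'); split; [now repeat split|].
    unfold stage_step; simpl; repeat split; auto; tauto. }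
  set (g := hd e w) in *.
  set (B := fun y => span (tl w) (conjg (inv g) y)).
  assert (hB : fg B) by apply fg_conj, span_fg.
  assert (iB : ~ cofinite B).
  { intros HB; apply Hc; apply (cofinite_conj g) in HB.
    revert HB; apply cofinite_mono; unfold B; intros x; now rewrite conjKV. }
  destruct (adjoin_fin_idx_part A B hA iA hB iB) as [U [hU iU]].
  destruct (separate_list A F' hA HF') as [V [hV [AV FV]]].
  assert (hUV : fin_idx (fun y => U y /\ V y)) by now apply fin_idx_inter.
  exists (join A (fun y => B y /\ U y /\ V y), F'); repeat split; simpl; auto.
  - apply join_fg; auto; now apply fg_inter_fin_idx.
  - intros H; apply iU; revert H; apply cofinite_mono.
    intros x; apply gen_min; [apply gen_sub|].
    intros y Hy; apply gen_in; tauto.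
  - intros x Hx Jx; apply (FV x Hx); revert Jx; apply gen_min; [apply hV|].
    intros y [Hy|Hy]; [auto|tauto].
  - intros x Hx; apply gen_in; auto.
  - intros _; exists (fun y => U y /\ V y); split; auto.
    intros y Hy Uy; apply gen_in; right; split; auto.
    unfold B; now rewrite conjKV.
Qed.

(** [H] is the union of a chain of stages in which step [n] serves the word coded by [n]; every word
    has a code. Requests stay met, since subgroups and forbidden lists only grow. *)
Lemma absorbing_subgroup : exists H, sub H /\
  (forall s, NoDup s -> (forall x, In x s -> core H x) ->
     c * INR (length s) <= INR (length sg)) /\
  (forall L g, fg L -> ~ cofinite L -> exists U, fin_idx U /\
     forall y, L y -> U (conjg g y) -> H (conjg g y)).
Proof.
  destruct (countable_group (ex_intro _ sg (fun x => conj (fun _ => Hsg x) (fun _ => I))))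
    as [enum Henum].
  destruct list_nat_enum as [dec Hdec].
  assert (Hword : forall w, exists n, map enum (dec n) = w).
  { intros w; assert (Hv : exists v, map enum v = w).
    { induction w as [|x w [v Hv]]; [now exists nil|].
      destruct (Henum x) as [n Hn]; exists (n :: v); simpl; congruence. }
    destruct Hv as [v <-]; destruct (Hdec v) as [n <-]; now exists n. }
  set (next := fun n (st : {st | good_stage st}) =>
    let (st', P) := constructive_indefinite_description _
      (stage_step_exists (map enum (dec n)) (proj1_sig st) (proj2_sig st)) in
    exist good_stage st' (proj1 P)).
  assert (st0 : {st | good_stage st}).
  { exists (span nil, nil); split; [apply span_fg|split].
    - apply trivial_not_cofinite.
    - intros x []. }
  set (st := fix st (n : nat) := match n with O => st0 | S n => next n (st n) end).
  set (A := fun n => fst (proj1_sig (st n))).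
  set (F := fun n => snd (proj1_sig (st n))).
  assert (Hst : forall n, stage_step (map enum (dec n)) (proj1_sig (st n))
                            (proj1_sig (st (S n)))).
  { intros n; simpl; unfold next.
    destruct (constructive_indefinite_description _ _) as [st' P]; apply P. }
  assert (HA : forall n m x, (n <= m)%nat -> A n x -> A m x).
  { induction 1; auto; intros Hx; now apply Hst, IHle. }
  assert (HF : forall n m x, (n <= m)%nat -> In x (F n) -> In x (F m)).
  { induction 1; auto; intros Hx; now apply Hst, IHle. }
  assert (sA : forall n, sub (A n)).
  { intros n; apply fg_sub, (proj2_sig (st n)). }
  exists (fun x => exists n, A n x); repeat split.
  - exists O; now apply sub_e.
  - intros x y [n Hn] [m Hm]; exists (max n m).
    apply sub_m; auto; [apply (HA n)|apply (HA m)]; auto; lia.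
  - intros x [n Hn]; exists n; now apply sub_v.
  - intros s Ns Hs; apply Rnot_lt_le; intros Hlt.
    destruct (Hword s) as [n Hn].
    destruct (Hst n) as [_ [_ [_ HN]]]; rewrite Hn in HN.
    destruct (HN Ns Hlt) as [x [y [Hy HFy]]].
    destruct (Hs y Hy x) as [m Hm].
    (* This stage is late enough to contain the conjugate and to forbid it. *)
    destruct (proj2_sig (st (max (S n) m))) as [_ [_ Hav]].
    apply (Hav (conjg x y)).
    + apply (HF (S n)); auto; lia.
    + apply (HA m); auto; lia.
  - intros L g [l Hl] iL; destruct (Hword (g :: l)) as [n Hn].
    destruct (Hst n) as [_ [_ [HU _]]]; rewrite Hn in HU; simpl in HU.
    destruct HU as [U [hU HU]].
    + intros H; apply iL; revert H; apply cofinite_mono; intros x; apply Hl.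
    + exists U; split; auto; intros y Hy Uy; exists (S n).
      apply HU; auto; now apply Hl.
Qed.

(** * The action on right cosets *)

(** A coset is encoded as its membership predicate, so that equal cosets are equal points and no
    representative has to be chosen. *)
Definition coset_space (H : G -> Prop) : Type :=
  {P : G -> Prop | exists g, forall x, P x <-> H (x ** inv g)}.

Lemma coset_ext H (P Q : coset_space H) :
  (forall x, proj1_sig P x <-> proj1_sig Q x) -> P = Q.
Proof.
  destruct P as [P HP], Q as [Q HQ]; simpl; intros E.
  assert (P = Q) as ->.
  { apply functional_extensionality; intros x; now apply propositional_extensionality. }
  f_equal; apply proof_irrelevance.
Qed.

Lemma coset_action_proof H (P : coset_space H) (g : G) :
  exists h, forall x, proj1_sig P (x ** inv g) <-> H (x ** inv h).
Proof.
  destruct P as [P [h Hh]]; exists (h ** g); intros x; simpl.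
  rewrite Hh; now gsimp.
Qed.

Definition coset_action H (P : coset_space H) (g : G) : coset_space H :=
  exist _ (fun x => proj1_sig P (x ** inv g)) (coset_action_proof H P g).

Definition coset H (g : G) : coset_space H :=
  exist _ (fun x => H (x ** inv g)) (ex_intro _ g (fun x => iff_refl _)).

Lemma coset_surj H (P : coset_space H) : exists g, P = coset H g.
Proof.
  destruct (proj2_sig P) as [g Hg]; exists g; now apply coset_ext.
Qed.

Lemma coset_actionE H g h : coset_action H (coset H g) h = coset H (g ** h).
Proof. apply coset_ext; intros x; simpl; now gsimp. Qed.

Lemma coset_eq H g h : sub H -> coset H g = coset H h <-> H (g ** inv h).
Proof.
  intros sH; split.
  - intros E; change (proj1_sig (coset H h) g); rewrite <- E; simpl.
    rewrite mulVr; now apply sub_e.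
  - intros Hgh; apply coset_ext; intros x; simpl; split; intros Hx.
    + replace (x ** inv h) with ((x ** inv g) ** (g ** inv h)) by now gsimp.
      now apply sub_m.
    + replace (x ** inv g) with ((x ** inv h) ** inv (g ** inv h)) by now gsimp.
      apply sub_m; auto; now apply sub_v.
Qed.

(** Elements fixing every coset lie in the core of [H], whose size is bounded. The coset of [g] is
    fixed by those [y] in [L] with [conjg g y] in [U]; they have finite index in [L], so the orbit
    is finite. *)
Lemma virtually_faithful_locally_finite_action :
  exists (X : Type) (act : X -> G -> X),
    inhabited X /\
    is_right_action G mul e X act /\
    transitive_action G X act /\
    finite_set (fun g : G => forall x : X, act x g = x) /\
    (forall L : G -> Prop, fg L -> ~ cofinite L ->
       forall x : X, finite_set (fun y : X => exists l, L l /\ act x l = y)).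
Proof.
  destruct absorbing_subgroup as [H [sH [Hcore HL]]].
  exists (coset_space H), (coset_action H); split; [exact (inhabits (coset H e))|].
  split; [split|split; [|split]].
  - intros P; destruct (coset_surj H P) as [g ->]; rewrite coset_actionE; now gsimp.
  - intros P g h; destruct (coset_surj H P) as [k ->].
    rewrite !coset_actionE; now gsimp.
  - intros P Q; destruct (coset_surj H P) as [g ->], (coset_surj H Q) as [h ->].
    exists (inv g ** h); rewrite coset_actionE; now gsimp.
  - destruct (archimedean_nat (INR (length sg) / c)) as [n Hn].
    (* Either fewer than [n] elements exhaust the core, or it has [n] distinct ones, against
       [c n > |sg|]. *)
    destruct (cover_or_scattered G (core H) eq n)
      as [[l [_ [_ [_ Hl]]]]|[l [Hlen [Hl Nl]]]].
    + exists l; intros g Hg; destruct (Hl g) as [t [Ht ->]]; auto.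
      intros h; specialize (Hg (coset H h)); rewrite coset_actionE in Hg.
      now apply coset_eq in Hg.
    + apply NoDup_ForallOrdPairs in Nl.
      pose proof (Hcore l Nl Hl) as HR; rewrite Hlen in HR.
      apply (Rmult_lt_compat_l c) in Hn; auto.
      replace (c * (INR (length sg) / c)) with (INR (length sg)) in Hn by (field; lra).
      lra.
  - intros L hL iL P; destruct (coset_surj H P) as [g ->].
    destruct (HL L g hL iL) as [U [hU HU]].
    destruct (fin_idx_transversal L _ (fin_idx_conj g U hU)) as [ts [T1 [T2 _]]].
    exists (map (fun t => coset H (g ** t)) ts).
    intros Q [l [Hl <-]]; destruct (T2 l Hl) as [t [Ht Ut]].
    apply in_map_iff; exists t; split; auto.
    rewrite coset_actionE; symmetry; apply coset_eq; auto.
    replace (g ** l ** inv (g ** t)) with (conjg g (l ** inv t))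
      by (unfold conjg; now gsimp).
    apply HU; auto. assert (sL := fg_sub L hL).
    apply sub_m; auto; apply sub_v; auto.
Qed.

End Groups.

(** * Return to the notions of the statement *)

Theorem theorem1p3 (G : Type) (mul : G -> G -> G) (e : G) (inv : G -> G)
  (HG : IsGroup G mul e inv)
  (Hfg : fin_gen_group G mul e inv)
  (HLERF : LERF G mul e inv)
  (Hrg : exists r, rank_gradient_is G mul e inv r /\ 0 < r) :
  exists (X : Type) (act : X -> G -> X),
    inhabited X /\
    is_right_action G mul e X act /\
    transitive_action G X act /\
    finite_set (fun g : G => forall x : X, act x g = x) /\
    (forall L : G -> Prop,
       fin_gen_subgroup G mul e inv L ->
       ~ (exists n, index_eq G mul e inv L n) ->
       forall x : X, finite_set (fun y : X => exists l, L l /\ act x l = y)).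
Proof.
  destruct (rank_gradient_bound G mul e inv HG Hrg) as [c [c_pos Hc]].
  destruct Hfg as [sg [_ [_ Hsg]]].
  destruct (virtually_faithful_locally_finite_action G mul e inv HG HLERF c c_pos Hc sg
              (fun x => proj1 (Hsg x) I)) as [X [act [H1 [H2 [H3 [H4 H5]]]]]].
  exists X, act; repeat (split; [assumption|]).
  intros L [sL [l [_ [_ Hl]]]] iL; apply H5.
  - now exists l.
  - intros cL; apply iL; now apply (index_eq_cofinite G mul e inv HG L sL).
Qed.
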